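(* Let $M_{1/2} := \mathbb{N}_0[\frac12]$ be the additive monoid of nonnegative dyadic rationals. If an irreducible polynomial $P(x) \in \mathbb{Z}[x]$ is not atomic as an element of the monoid algebra $\mathbb{Q}[M_{1/2}]$, then $P(x) \in \{\pm x\} \cup \{\pm \Phi_n(x) : n \text{ a positive odd integer}\}$.
   Context: $\mathbb{Q}[M_{1/2}]$ is the integral domain of polynomial expressions $\sum c_i x^{m_i}$ with $c_i \in \mathbb{Q}$ and $m_i \in M_{1/2}$, containing $\mathbb{Z}[x]$. An element of an integral domain is atomic if it is a unit or a finite product of irreducible elements. $\Phi_n(x)$ denotes the $n$-th cyclotomic polynomial. *)

(* Defs.v *)
From HB Require Import structures.
From mathcomp Require Import all_boot all_order all_algebra all_field.
Set Implicit Arguments. Unset Strict Implicit. Unset Printing Implicit Defensive.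
Import Order.TTheory GRing.Theory Num.Theory.
Local Open Scope ring_scope.

Definition ring_irreducible (R : comUnitRingType) (a : R) : Prop :=
  a != 0 /\ a \isn't a GRing.unit /\
  forall b c : R, a = b * c -> b \is a GRing.unit \/ c \is a GRing.unit.

(* The monoid algebra Q[M_{1/2}], M_{1/2} = N_0[1/2].
   An element is represented by a pair (k, p) with p : {poly rat},
   standing for p(x^{1/2^k}) = sum_i p_i x^{i/2^k}.  Every element of
   Q[M_{1/2}] has such a representation. *)
Definition dyad := (nat * {poly rat})%type.

(* the representative of a at level n (meaningful when a.1 <= n):
   p(y^{2^(n-k)}), where y = x^{1/2^n} *)
Definition dlift (n : nat) (a : dyad) : {poly rat} :=
  a.2 \Po 'X^(2 ^ (n - a.1)).

Definition deq (a b : dyad) : Prop :=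
  dlift (maxn a.1 b.1) a = dlift (maxn a.1 b.1) b.

Definition dmul (a b : dyad) : dyad :=
  (maxn a.1 b.1, dlift (maxn a.1 b.1) a * dlift (maxn a.1 b.1) b).

Definition done : dyad := (0%N, 1).

Definition dzero (a : dyad) : Prop := a.2 = 0.

Definition dunit (a : dyad) : Prop := exists b, deq (dmul a b) done.

Definition dirreducible (a : dyad) : Prop :=
  ~ dzero a /\ ~ dunit a /\
  forall b c, deq a (dmul b c) -> dunit b \/ dunit c.

Definition datomic (a : dyad) : Prop :=
  dunit a \/
  exists s : seq dyad, s <> [::] /\ (forall b, b \in s -> dirreducible b) /\
    deq a (foldr dmul done s).

Definition dofZ (P : {poly int}) : dyad := (0%N, map_poly intr P).

(* Main.v *)
Require Import Defs.
From HB Require Import structures.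
From mathcomp Require Import all_boot all_order all_algebra all_field.
From mathcomp Require Import ring zify.
From Stdlib Require Import Classical.
Import Order.TTheory GRing.Theory Num.Theory.
Local Open Scope ring_scope.

(** Atomicity of [P] fails only if the number of irreducible factors of [P(X^(2^k))] over [Q] grows without bound. Let [b] be a nonzero root of an irreducible polynomial [p]. If [b] is not a square in [Q(b)], then [p(X^2)] is irreducible; otherwise, with [b = g^2] and [g] in [Q(b)], it divides [q(X) q(-X)] for the minimal polynomial [q] of [g], and one continues with [g] and [-g]. If a nonsplitting step is followed by a splitting one, then [-1] has become a square in the field, and after that no such pattern can occur again; so eventually every step splits and some root, again called [b], is a [2^N]-th power in [Q(b)] for every [N]. If [b] is not a root of unity, this is impossible: the primitive minimal polynomials of the [2^N]-th roots in [Q(b)] would have bounded degree and coefficients, hence two of them would coincide, and some power map [z => z^n], [n > 1], would map the roots of [p] to themselves. If [b] is a primitive [n]-th root of unity with [n] even, then [Phi_n(X^(2^k)) = Phi_(2^k n)] is irreducible for every [k]. *)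

Set Implicit Arguments.
Unset Strict Implicit.

Local Notation toC := (map_poly (ratr : rat -> algC)).
Local Notation toQ := (map_poly (intr : int -> rat)).

(** * Arithmetic of representatives *)

Lemma comp_polyXnXn (R : comNzRingType) (p : {poly R}) (m n : nat) :
  (p \Po 'X^m) \Po 'X^n = p \Po 'X^(m * n).
Proof. by rewrite -comp_polyA comp_Xn_poly -exprM mulnC. Qed.

Lemma comp_polyXn_inj (R : idomainType) (n : nat) :
  (0 < n)%N -> injective (fun p : {poly R} => p \Po 'X^n).
Proof.
move=> n_gt0 p q /eqP; rewrite -subr_eq0 -comp_polyB comp_poly_eq0.
  by rewrite subr_eq0 => /eqP.
by rewrite size_polyXn.
Qed.

Lemma dlift_dlift (m n : nat) (a : dyad) : (a.1 <= m)%N -> (m <= n)%N ->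
  dlift n a = dlift m a \Po 'X^(2 ^ (n - m)).
Proof.
move=> am mn; rewrite /dlift comp_polyXnXn -expnD; congr (_ \Po 'X^(2 ^ _)).
lia.
Qed.

(** Substituting a positive power of [X] is injective, so any common level may replace the maximum
    of the two levels. *)
Lemma deqP (n : nat) (a b : dyad) : (a.1 <= n)%N -> (b.1 <= n)%N ->
  deq a b <-> dlift n a = dlift n b.
Proof.
move=> an bn; have mn : (maxn a.1 b.1 <= n)%N by rewrite geq_max an.
rewrite /deq (dlift_dlift (leq_maxl _ _) mn) (dlift_dlift (leq_maxr _ _) mn).
by split=> [->//|/comp_polyXn_inj]; apply; rewrite expn_gt0.
Qed.

Lemma dlift_mul (n : nat) (a b : dyad) : (a.1 <= n)%N -> (b.1 <= n)%N ->
  dlift n (dmul a b) = dlift n a * dlift n b.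
Proof.
move=> an bn; have mn : (maxn a.1 b.1 <= n)%N by rewrite geq_max an.
rewrite (dlift_dlift (leq_maxl _ _) mn) (dlift_dlift (leq_maxr _ _) mn).
by rewrite -comp_polyM.
Qed.

Lemma dlift_done (n : nat) : dlift n done = 1.
Proof. by rewrite /dlift comp_polyC. Qed.

Lemma deq_sym (a b : dyad) : deq a b -> deq b a.
Proof.
move=> /(deqP (leq_maxl _ _) (leq_maxr _ _)) e.
by apply/(deqP (leq_maxr _ _) (leq_maxl _ _)).
Qed.

Lemma deq_trans (a b c : dyad) : deq a b -> deq b c -> deq a c.
Proof.
set n := maxn a.1 (maxn b.1 c.1) => ab bc.
have [an bn cn] : [/\ a.1 <= n, b.1 <= n & c.1 <= n]%N by split; lia.
by apply/(deqP an cn); rewrite (deqP an bn).1 //; apply/(deqP bn cn).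
Qed.

Lemma deq_mul (a a' b b' : dyad) :
  deq a a' -> deq b b' -> deq (dmul a b) (dmul a' b').
Proof.
set n := maxn (maxn a.1 a'.1) (maxn b.1 b'.1) => aa bb.
have [an a'n bn b'n] : [/\ a.1 <= n, a'.1 <= n, b.1 <= n & b'.1 <= n]%N
  by split; lia.
apply/(@deqP n); rewrite /= ?geq_max ?an ?bn ?a'n ?b'n //.
by rewrite !dlift_mul // (deqP an a'n).1 // (deqP bn b'n).1.
Qed.

Lemma dmulA (a b c : dyad) : deq (dmul a (dmul b c)) (dmul (dmul a b) c).
Proof.
set n := maxn a.1 (maxn b.1 c.1).
have [an bn cn] : [/\ a.1 <= n, b.1 <= n & c.1 <= n]%N by split; lia.
have bcn : (maxn b.1 c.1 <= n)%N by rewrite geq_max bn.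
have abn : (maxn a.1 b.1 <= n)%N by rewrite geq_max an.
by apply/(@deqP n); rewrite /= ?geq_max ?an ?bn ?cn // !dlift_mul // mulrA.
Qed.

Lemma dmulC (a b : dyad) : deq (dmul a b) (dmul b a).
Proof.
set n := maxn a.1 b.1.
have [an bn] : (a.1 <= n)%N /\ (b.1 <= n)%N by split; lia.
by apply/(@deqP n); rewrite /= ?geq_max ?an ?bn // !dlift_mul // mulrC.
Qed.

Lemma dmul1 (a : dyad) : deq (dmul done a) a.
Proof.
apply/(@deqP a.1); rewrite /= ?max0n //.
by rewrite dlift_mul // dlift_done mul1r.
Qed.

Lemma deq_refl (a : dyad) : deq a a. Proof. by []. Qed.

Lemma dunit_mul (a b : dyad) : dunit a -> dunit b -> dunit (dmul a b).
Proof.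
move=> [a' aa'] [b' bb']; exists (dmul b' a').
apply: deq_trans (deq_sym (dmulA _ _ _)) _.
apply: deq_trans aa'; apply: deq_mul (deq_refl _) _.
apply: deq_trans (dmulA _ _ _) _.
by apply: deq_trans (deq_mul bb' (deq_refl a')) (dmul1 _).
Qed.

Lemma dunit_deq (a b : dyad) : deq a b -> dunit a -> dunit b.
Proof.
move=> ab [c ac]; exists c.
exact: deq_trans (deq_mul (deq_sym ab) (deq_refl c)) ac.
Qed.

(** Lifting multiplies the degree by a power of 2, and at a common level a divisor of [1] has degree
    0. *)
Lemma dunitP (k : nat) (p : {poly rat}) : dunit (k, p) <-> size p = 1%N.
Proof.
split=> [[b]|/eqP/size_poly1P[c c0 ->]].
  set n := maxn k b.1.
  have [kn bn] : ((k, p).1 <= n)%N /\ (b.1 <= n)%N by split; rewrite /= ?leq_maxl ?leq_maxr.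
  have mn : (maxn k b.1 <= n)%N by [].
  move/(deqP (a := dmul (k, p) b) (b := done) mn (leq0n n)).
  rewrite dlift_mul // dlift_done => e.
  have := oner_eq0 {poly rat}; rewrite -e mulf_eq0 => /norP[u0 v0].
  have := size_mul u0 v0; rewrite e size_poly1.
  have [su sv] : (0 < size (dlift n (k, p)) /\ 0 < size (dlift n b))%N by rewrite !size_poly_gt0.
  have p0 : p != 0 by apply: contraNneq u0 => ->; rewrite /dlift comp_poly0.
  move=> suv; have : ((size (dlift n (k, p))).-1 = 0)%N.
    by move: suv su sv; case: (size _) => [|[|x]] //; case: (size _) => [|y] //; lia.
  rewrite size_comp_poly size_polyXn /= => /eqP; rewrite muln_eq0 expn_eq0 orbF.
  by have := size_poly_gt0 p; rewrite p0; case: (size p) => [|[|x]] //; case: eqP => //; lia.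
exists (k, c^-1%:P); apply/(@deqP k); rewrite /= ?maxnn //.
by rewrite dlift_mul // /dlift !comp_polyC -polyCM divff.
Qed.

(** [datomic] leaves no room for a unit beside the irreducible factors; this lets a unit be absorbed
    into one of them. *)
Lemma dirreducible_mul_unit (a u : dyad) :
  dunit u -> dirreducible a -> dirreducible (dmul u a).
Proof.
move=> uu [a0 [au airr]]; have [v uv] := uu.
have vua : deq (dmul v (dmul u a)) a.
  apply: deq_trans (dmulA _ _ _) _.
  apply: deq_trans (dmul1 a); apply: deq_mul (deq_refl a).
  exact: deq_trans (dmulC _ _) uv.
have vU : dunit v by exists u; apply: deq_trans (dmulC _ _) uv.
split=> [e|]; last split.
- apply: a0; move: vua => /(@deqP (maxn v.1 (maxn u.1 a.1))) /=.
  have [h1 h2 h3] : [/\ v.1 <= maxn v.1 (maxn u.1 a.1),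
    u.1 <= maxn v.1 (maxn u.1 a.1) & a.1 <= maxn v.1 (maxn u.1 a.1)]%N by split; lia.
  have h4 : ((dmul u a).1 <= maxn v.1 (maxn u.1 a.1))%N by rewrite /=; lia.
  move=> /(_ (leqnn _) h3); rewrite dlift_mul //.
  rewrite {2}/dlift [(dmul u a).2]e comp_poly0 mulr0.
  move=> /esym /eqP; rewrite comp_poly_eq0 ?size_polyXn // ?ltnS ?expn_gt0 //.
  by move/eqP.
- by move=> /(dunit_mul vU) /(dunit_deq vua).
- move=> b c e; have [] := airr (dmul v b) c.
  + apply: deq_trans (deq_sym vua) _.
    exact: deq_trans (deq_mul (deq_refl v) e) (dmulA _ _ _).
  + move=> /(dunit_mul uu) h; left; apply: dunit_deq h.
    apply: deq_trans (dmulA _ _ _) _.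
    exact: deq_trans (deq_mul uv (deq_refl b)) (dmul1 b).
  + by right.
Qed.

(** * Stability of atomicity *)

Lemma datomic_deq (a b : dyad) : deq a b -> datomic a -> datomic b.
Proof.
move=> ab [au|[s [s0 [sirr sa]]]]; first by left; apply: dunit_deq au.
by right; exists s; split=> //; split=> //; apply: deq_trans (deq_sym ab) sa.
Qed.

Lemma datomic_mul_unit (u a : dyad) : dunit u -> datomic a -> datomic (dmul u a).
Proof.
move=> uu [au|[[|b s] [// _ [sirr sa]]]]; first by left; apply: dunit_mul.
right; exists (dmul u b :: s); split=> //; split=> [c|].
  rewrite inE => /predU1P[->|cs]; last by apply: sirr; rewrite inE cs orbT.
  by apply: dirreducible_mul_unit => //; apply: sirr; rewrite inE eqxx.
exact: deq_trans (deq_mul (deq_refl u) sa) (dmulA _ _ _).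
Qed.

Lemma foldr_dmul_cat (s t : seq dyad) :
  deq (foldr dmul done (s ++ t)) (dmul (foldr dmul done s) (foldr dmul done t)).
Proof.
elim: s => [|a s IHs] /=; first exact/deq_sym/dmul1.
exact: deq_trans (deq_mul (deq_refl a) IHs) (dmulA _ _ _).
Qed.

Lemma datomic_mul (a b : dyad) : datomic a -> datomic b -> datomic (dmul a b).
Proof.
move=> [au|[s [s0 [sirr sa]]]] ab; first exact: datomic_mul_unit.
case: ab => [bu|[t [_ [tirr tb]]]].
  by apply: datomic_deq (dmulC _ _) (datomic_mul_unit bu _); right; exists s.
right; exists (s ++ t); split; first by case: s s0 {sirr sa}.
split=> [c|]; first by rewrite mem_cat => /orP[/sirr|/tirr].
exact: deq_trans (deq_mul sa tb) (deq_sym (foldr_dmul_cat _ _)).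
Qed.

Lemma datomic_polyM (k : nat) (p q : {poly rat}) :
  datomic (k, p) -> datomic (k, q) -> datomic (k, p * q).
Proof.
move=> pa qa; apply: datomic_deq (datomic_mul pa qa).
by apply/(@deqP k); rewrite /= ?maxnn // dlift_mul // /dlift comp_polyM.
Qed.

Lemma datomic_const (k : nat) (p : {poly rat}) : size p = 1%N -> datomic (k, p).
Proof. by move=> p1; left; apply/dunitP. Qed.

Lemma datomic_eqp (k : nat) (p q : {poly rat}) :
  p %= q -> datomic (k, p) -> datomic (k, q).
Proof.
rewrite eqp_sym => /eqpP[[c d] /= /andP[c0 d0] e] pa.
have -> : q = (c^-1 * d)%:P * p by rewrite mul_polyC -scalerA -e scalerA mulVf ?scale1r.
by apply: datomic_polyM pa; apply: datomic_const; rewrite size_polyC mulf_neq0 ?invr_eq0.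
Qed.

Lemma datomic_levelS (k m : nat) (p : {poly rat}) :
  datomic ((k + m)%N, p \Po 'X^(2 ^ m)) -> datomic (k, p).
Proof.
apply: datomic_deq; apply/(@deqP (k + m)); rewrite //= ?leq_addr //.
by rewrite /dlift /= subnn comp_polyXr addKn.
Qed.

(** A factorization in the algebra already takes place at some finite level [n], where the element
    becomes the irreducible polynomial [p(X^(2^(n-k)))]. Hence the element is itself irreducible. *)
Lemma datomic_irreducible (k : nat) (p : {poly rat}) :
  (forall m, irreducible_poly (p \Po 'X^(2 ^ m))) -> datomic (k, p).
Proof.
move=> irr; right; exists [:: (k, p)]; split=> //; split; last first.
  exact/deq_sym/(deq_trans (dmulC _ _))/dmul1.
have irrp : irreducible_poly p by have := irr 0%N; rewrite comp_polyXr.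
move=> b; rewrite inE => /eqP->; split; last split.
- by move/eqP; rewrite (negPf (irredp_neq0 irrp)).
- by move/dunitP=> p1; have [] := irrp; rewrite p1.
move=> [i b'] [j c]; set n := maxn k (maxn i j).
have [kn bn cn] : [/\ (k <= n)%N, (i <= n)%N & (j <= n)%N] by split; lia.
have mn : (maxn i j <= n)%N by lia.
move/(deqP (a := (k, p)) (b := dmul (i, b') (j, c)) kn mn).
rewrite dlift_mul // {1}/dlift => e; have {}irr := irr (n - k)%N.
have dl l (q : {poly rat}) :
    (l <= n)%N -> size (dlift n (l, q)) = 1%N -> dunit (l, q).
  move=> ln /(dunitP n); apply: dunit_deq.
  by apply/(@deqP n) => //=; rewrite /dlift /= subnn comp_polyXr.
have [s1|s1] := eqVneq (size (dlift n (i, b'))) 1%N; first by left; apply: dl.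
right; apply: dl => //.
have := irr.2 _ s1; rewrite e dvdp_mulr // => /(_ isT).
have := irredp_neq0 irr; rewrite /= e mulf_eq0 => /norP[u0 v0].
by rewrite -{1}[dlift n (i, b')]mulr1 eqp_mul2l // eqp_sym -size_poly_eq1 => /eqP.
Qed.

(** * Irreducible rational polynomials and their complex roots *)

(** If [p] did not divide [q], a Bezout identity [u p + v q = 1] would fail at the common root
    [a]. *)
Lemma irredp_root_dvdp (p q : {poly rat}) (a : algC) :
  irreducible_poly p -> root (toC p) a -> root (toC q) a = (p %| q).
Proof.
move=> irrp pa; apply/idP/idP => [qa|/dvdpP[r ->]]; last first.
  by rewrite rmorphM rootM pa orbT.
rewrite -[_ %| _]negbK -irreducible_poly_coprime //.
apply/negP => /Bezout_eq1_coprimepP[[u v] /= /(congr1 (fun r => (toC r).[a]))].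
rewrite rmorphD !rmorphM rmorph1 !hornerE (rootP pa) (rootP qa) !mulr0 addr0.
by move/eqP; rewrite eq_sym oner_eq0.
Qed.

Lemma algC_irredp (a : algC) :
  exists2 p : {poly rat}, irreducible_poly p & root (toC p) a.
Proof.
have [p [ep mp dvp]] := minCpolyP a; exists p; last by rewrite -ep root_minCpoly.
split=> [|q q1 qp]; first by have := size_minCpoly a; rewrite ep size_map_poly.
rewrite /eqp qp; have [r er] := dvdpP _ _ qp.
have p0 := monic_neq0 mp; move: (p0); rewrite er mulf_eq0 => /norP[r0 q0].
have : root (toC (r * q)) a by rewrite -er -ep root_minCpoly.
rewrite rmorphM rootM !dvp -er => /orP[/(dvdp_leq r0)|//].
rewrite er size_mul //; have := size_poly_gt0 q; rewrite q0; move: q1.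
by case: (size q) => [|[|n]] //; lia.
Qed.

Lemma irredp_algC_root (p : {poly rat}) :
  irreducible_poly p -> exists a : algC, root (toC p) a.
Proof.
move=> [p1 _]; have [|a pa] := @closed_rootP _ (toC p) _; last by exists a.
by rewrite size_map_poly neq_ltn p1 orbT.
Qed.

(** * The field generated by an algebraic number *)

(* [x] lies in [Q(a)], which equals [Q[a]] because [a] is algebraic. *)
Definition Qgen (a x : algC) : Prop := exists h : {poly rat}, x = (toC h).[a].

Lemma Qgen_id (a : algC) : Qgen a a.
Proof. by exists 'X; rewrite map_polyX hornerX. Qed.

Lemma Qgen_ratr (a : algC) (c : rat) : Qgen a (ratr c).
Proof. by exists c%:P; rewrite map_polyC hornerC. Qed.

Lemma Qgen_trans (a x y : algC) : Qgen a x -> Qgen x y -> Qgen a y.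
Proof.
move=> [h ->] [g ->]; exists (g \Po h).
by rewrite map_comp_poly horner_comp.
Qed.

Lemma Qgen_add (a x y : algC) : Qgen a x -> Qgen a y -> Qgen a (x + y).
Proof. by move=> [h ->] [g ->]; exists (h + g); rewrite rmorphD hornerD. Qed.

Lemma Qgen_mul (a x y : algC) : Qgen a x -> Qgen a y -> Qgen a (x * y).
Proof. by move=> [h ->] [g ->]; exists (h * g); rewrite rmorphM hornerM. Qed.

Lemma Qgen_opp (a x : algC) : Qgen a x -> Qgen a (- x).
Proof. by move=> [h ->]; exists (- h); rewrite rmorphN hornerN. Qed.

Lemma Qgen_exp (a x : algC) (n : nat) : Qgen a x -> Qgen a (x ^+ n).
Proof. by move=> [h ->]; exists (h ^+ n); rewrite rmorphXn horner_exp. Qed.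

(** The inverse comes from a Bezout identity between [h] and a minimal polynomial of [a]; for
    [x = 0] it is [0] by convention. *)
Lemma Qgen_inv (a x : algC) : Qgen a x -> Qgen a x^-1.
Proof.
move=> [h ->]; have [p irrp pa] := algC_irredp a.
have [e|h0] := eqVneq (toC h).[a] 0.
  by exists 0; rewrite e invr0 rmorph0 horner0.
have : coprimep p h.
  by rewrite irreducible_poly_coprime // -(irredp_root_dvdp _ irrp pa).
move/Bezout_eq1_coprimepP => [[u v] /= /(congr1 (fun r => (toC r).[a]))].
rewrite rmorphD !rmorphM rmorph1 !hornerE (rootP pa) mulr0 add0r => e.
by exists v; apply: (mulIf h0); rewrite e mulVf.
Qed.

(** * Square roots of algebraic numbers *)

Lemma root_comp_polyXn (p : {poly rat}) (n : nat) (a : algC) :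
  root (toC (p \Po 'X^n)) a = root (toC p) (a ^+ n).
Proof. by rewrite map_comp_poly map_polyXn /root horner_comp hornerXn. Qed.

(** This puts any element of [Q(g)] in the form [u + v g] with [u], [v] in [Q(g^2)]. *)
Lemma horner_even_odd (q : {poly rat}) (g : algC) :
  (toC q).[g] = (toC (even_poly q)).[g ^+ 2] + (toC (odd_poly q)).[g ^+ 2] * g.
Proof.
have /(congr1 (fun r => (toC r).[g])) <- := poly_even_odd q.
rewrite rmorphD /= rmorphM /= !map_comp_poly map_polyX !map_polyXn.
by rewrite hornerD hornerM !horner_comp !hornerE.
Qed.

(** Let [q] be a minimal polynomial of [g], so that [u + v g = 0] with [u], [v] its even and odd
    parts at [g^2]. If [v] were nonzero, [g = - u / v] would lie in [Q(g^2)]. So both parts vanish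
    at [g^2], [p] divides them, and [p(X^2)] divides [q]. *)
Lemma irredp_comp_X2 (p : {poly rat}) (g : algC) :
  irreducible_poly p -> root (toC p) (g ^+ 2) -> ~ Qgen (g ^+ 2) g ->
  irreducible_poly (p \Po 'X^2).
Proof.
move=> irrp pb ng; have [q irrq qg] := algC_irredp g.
have p2g : root (toC (p \Po 'X^2)) g by rewrite root_comp_polyXn.
suff pq : p \Po 'X^2 %| q.
  have /eqp_size : q %= p \Po 'X^2 by rewrite /eqp pq andbT -(irredp_root_dvdp _ irrq qg).
  move=> es; split=> [|r r1 rp]; first by rewrite -es; case: irrq.
  have := irrq.2 r r1 (dvdp_trans rp pq) => rq.
  by rewrite /eqp rp (eqp_dvdr _ rq) pq.
have := horner_even_odd q g; rewrite (rootP qg).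
set u := (toC (even_poly q)).[_]; set v := (toC (odd_poly q)).[_] => e.
have [v0|v0] := eqVneq v 0; last first.
  case: ng; have eg : g = - u * v^-1.
    apply: (mulIf v0); rewrite mulfVK //; apply/eqP; rewrite -subr_eq0 opprK e; apply/eqP.
    by ring.
  rewrite [X in Qgen _ X]eg; apply: Qgen_mul; first by apply: Qgen_opp; exists (even_poly q).
  by apply: Qgen_inv; exists (odd_poly q).
have u0 : u = 0 by rewrite e v0 mul0r addr0.
rewrite -(poly_even_odd q); apply: dvdp_add; last apply: dvdp_mulr.
- by rewrite dvdp_comp_poly // -(irredp_root_dvdp _ irrp pb); apply/rootP.
- by rewrite dvdp_comp_poly // -(irredp_root_dvdp _ irrp pb); apply/rootP.
Qed.

Lemma irredp_compN (p : {poly rat}) :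
  irreducible_poly p -> irreducible_poly (p \Po (- 'X)).
Proof.
have compNN (q : {poly rat}) : (q \Po - 'X) \Po - 'X = q.
  by rewrite -comp_polyA raddfN /= comp_polyX opprK comp_polyXr.
have sN (q : {poly rat}) : size (q \Po - 'X) = size q.
  by rewrite size_comp_poly2 // size_polyN size_polyX.
move=> [p1 irrp]; split=> [|q q1 qp]; first by rewrite sN.
have := dvdp_comp_poly (- 'X) qp; rewrite compNN => qp'.
have q1' : size (q \Po - 'X) != 1%N by rewrite sN.
have /andP[_ pq] := irrp _ q1' qp'.
by rewrite /eqp qp -[q]compNN dvdp_comp_poly.
Qed.

(** One level up, [p(X^2)] is a multiple of [q] and divides [q(X) q(-X)]. The cofactor divides the
    irreducible [q(-X)], so it is a constant or an associate of [q(-X)]. *)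
Lemma datomic_sqrt (p : {poly rat}) (g : algC) :
  irreducible_poly p -> root (toC p) (g ^+ 2) ->
  (forall (k : nat) (q : {poly rat}), irreducible_poly q ->
     root (toC q) g || root (toC q) (- g) -> datomic (k, q)) ->
  forall k : nat, datomic (k, p).
Proof.
move=> irrp pb at_g k; apply: (@datomic_levelS k 1).
have [q irrq qg] := algC_irredp g; have irrq' := irredp_compN irrq.
have qg' : root (toC (q \Po - 'X)) (- g).
  by rewrite map_comp_poly rmorphN /= map_polyX /root horner_comp !hornerE opprK.
have q2 : q %| p \Po 'X^2.
  by rewrite -(irredp_root_dvdp _ irrq qg) root_comp_polyXn.
(* The product [q(X) q(-X)] is invariant under [X -> -X], hence of the form [E(X^2)]; [E] vanishes
   at [g^2], so [p] divides it. *)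
pose E := even_poly q ^+ 2 - 'X * odd_poly q ^+ 2.
have eE : q * (q \Po - 'X) = E \Po 'X^2.
  have eq_q := poly_even_odd q.
  have -> : q \Po - 'X = even_poly q \Po 'X^2 - (odd_poly q \Po 'X^2) * 'X.
    rewrite -{1}eq_q comp_polyD comp_polyM comp_polyX mulrN.
    by rewrite -!comp_polyA !comp_Xn_poly !sqrrN.
  rewrite -{1}eq_q /E comp_polyB [('X * _) \Po _]comp_polyM comp_polyX !rmorphXn /=.
  by ring.
have p2 : p \Po 'X^2 %| q * (q \Po - 'X).
  rewrite eE dvdp_comp_poly // -(irredp_root_dvdp _ irrp pb) -root_comp_polyXn -eE.
  by rewrite rmorphM rootM qg.
have [r er] := dvdpP _ _ q2.
have q0 := irredp_neq0 irrq.
have r2 : r %| q \Po - 'X by rewrite -(dvdp_mul2l _ _ q0) mulrC -er.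
have [aq aq'] : datomic ((k + 1)%N, q) /\ datomic ((k + 1)%N, q \Po - 'X).
  by split; apply: at_g => //; rewrite ?qg ?qg' ?orbT.
rewrite /= er; apply: datomic_polyM aq.
have [r1|r1] := eqVneq (size r) 1%N; first exact: datomic_const.
by apply: datomic_eqp aq'; rewrite eqp_sym irrq'.2.
Qed.

(** * Square roots of -1 and the loss of irreducibility *)

Definition Qgen_i (a : algC) : Prop := exists2 j, Qgen a j & j ^+ 2 = -1.

Lemma Qgen_i_sub (a b : algC) : Qgen b a -> Qgen_i a -> Qgen_i b.
Proof. by move=> ba [j aj j2]; exists j => //; apply: Qgen_trans aj. Qed.

(* [g] has degree 2 over [Q(g^2)], so comparing coordinates on the basis [1, g] in [y^2 = g], where [y = s + t * g], gives [2 s t = 1] and [s^2 + t^2 g^2 = 0], that is [g^2 = - 4 s^4]. *)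
Lemma Qgen_sqrt_tower (g y : algC) :
  ~ Qgen (g ^+ 2) g -> Qgen g y -> y ^+ 2 = g ->
  exists2 u, Qgen (g ^+ 2) u & u != 0 /\ g ^+ 2 = - u ^+ 2.
Proof.
move=> ng [h ey] y2; move: ey; rewrite horner_even_odd.
set s := (toC (even_poly h)).[_]; set t := (toC (odd_poly h)).[_] => ey.
have Qs : Qgen (g ^+ 2) s by exists (even_poly h).
have Qt : Qgen (g ^+ 2) t by exists (odd_poly h).
have Q2 : Qgen (g ^+ 2) 2 by rewrite -(ratr_nat _ 2); apply: Qgen_ratr.
have Q1 : Qgen (g ^+ 2) 1 by rewrite -(rmorph1 (ratr : rat -> algC)); apply: Qgen_ratr.
move: s t ey Qs Qt => s t ey Qs Qt; pose d := 1 - 2 * s * t.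
have e : d * g = s ^+ 2 + g ^+ 2 * t ^+ 2.
  have e : (s + t * g) ^+ 2 = g by rewrite -ey.
  by rewrite /d mulrBl mul1r -{1}e; ring.
have [d0|d0] := eqVneq d 0; last first.
  have eg : g = (s ^+ 2 + g ^+ 2 * t ^+ 2) * d^-1.
    by apply: (mulIf d0); rewrite mulfVK // -e mulrC.
  case: ng; rewrite [X in Qgen _ X]eg; apply: Qgen_mul.
    by apply: Qgen_add; [|apply: Qgen_mul (Qgen_id _) _]; apply: Qgen_exp.
  apply: Qgen_inv; apply: Qgen_add => //; apply: Qgen_opp.
  by apply: Qgen_mul => //; apply: Qgen_mul.
have st : 2 * s * t = 1 by apply/eqP; rewrite eq_sym -subr_eq0 -/d d0.
have s0 : s != 0.
  by apply: contraNneq (oner_neq0 algC) => s0; rewrite -st s0; apply/eqP; ring.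
exists (2 * s ^+ 2); first by apply: Qgen_mul => //; apply: Qgen_exp.
split; first by rewrite mulf_neq0 ?expf_neq0 ?pnatr_eq0.
move: e; rewrite d0 mul0r => e.
have -> : g ^+ 2 = g ^+ 2 * (2 * s * t) ^+ 2 by rewrite st; ring.
have -> : g ^+ 2 * (2 * s * t) ^+ 2 = 4 * s ^+ 2 * (s ^+ 2 + g ^+ 2 * t ^+ 2) - (2 * s ^+ 2) ^+ 2.
  by ring.
by rewrite -e mulr0 add0r.
Qed.

(** From [g^2 = - u^2], the quotient [g / u] is a square root of -1. If one, [j], were already in
    [Q(g^2)], then [g] would be [j u] or its opposite and lie there too. *)
Lemma Qgen_i_sqrt_tower (g y : algC) :
  ~ Qgen (g ^+ 2) g -> Qgen g y -> y ^+ 2 = g ->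
  Qgen_i g /\ ~ Qgen_i (g ^+ 2).
Proof.
move=> ng gy y2; have [u Qu [u0 eg]] := Qgen_sqrt_tower ng gy y2.
have Qg2 : Qgen g (g ^+ 2) by apply/Qgen_exp/Qgen_id.
split.
  exists (g / u); last by rewrite expr_div_n eg mulNr divff // expf_neq0.
  exact/Qgen_mul/Qgen_inv/(Qgen_trans Qg2 Qu)/Qgen_id.
move=> [j Qj j2]; apply: ng.
have Qju : Qgen (g ^+ 2) (j * u) by apply: Qgen_mul.
have : g ^+ 2 == (j * u) ^+ 2 by rewrite exprMn j2 eg mulN1r.
by rewrite eqf_sqr => /orP[]/eqP eg'; rewrite [X in Qgen _ X]eg' //; apply: Qgen_opp.
Qed.

(* A root of [p(X^2)] and its opposite have the same minimal polynomial, which is irreducible and even, so neither lies in the field generated by their square. *)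
Lemma irredp_comp_X2_Qgen (p : {poly rat}) (g : algC) :
  g != 0 -> irreducible_poly (p \Po 'X^2) -> root (toC p) (g ^+ 2) ->
  ~ Qgen (g ^+ 2) g.
Proof.
move=> g0 irrp pg [h eh].
have p2g : root (toC (p \Po 'X^2)) g by rewrite root_comp_polyXn.
have p2Ng : root (toC (p \Po 'X^2)) (- g) by rewrite root_comp_polyXn sqrrN.
have rootE x : x ^+ 2 = g ^+ 2 -> root (toC ('X - (h \Po 'X^2))) x = (x == g).
  move=> ex; rewrite rmorphB /= map_comp_poly map_polyX map_polyXn /root.
  by rewrite hornerD hornerN horner_comp hornerXn hornerX ex -eh subr_eq0.
have := rootE _ (sqrrN g); rewrite (irredp_root_dvdp _ irrp p2Ng).
rewrite -(irredp_root_dvdp _ irrp p2g) rootE // eqxx => /esym/eqP e.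
have /eqP : g + g = 0 by rewrite -{1}e addNr.
by rewrite -mulr2n mulrn_eq0 (negPf g0).
Qed.

(* [g] is a [2^m]-th root of [b] at the first level where irreducibility is lost. *)
Lemma irredp_tower (p : {poly rat}) (b : algC) :
  b != 0 -> irreducible_poly p -> root (toC p) b ->
  ~ (exists2 y, Qgen b y & y ^+ 2 = b) ->
  (forall k, datomic (k, p)) \/
  exists (m : nat) (g : algC), [/\ g ^+ (2 ^ m.+1) = b,
    irreducible_poly (p \Po 'X^(2 ^ m.+1)), Qgen_i g & ~ Qgen_i (g ^+ 2)].
Proof.
move=> b0 irrp pb nsq.
have [irr|/not_all_ex_not[m0 nirr]] := classic (forall m, irreducible_poly (p \Po 'X^(2 ^ m))).
  by left=> k; apply: datomic_irreducible.
right; elim: m0 nirr => [|m IHm] nirr; first by case: nirr; rewrite comp_polyXr.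
have [irr|] := classic (irreducible_poly (p \Po 'X^(2 ^ m))); last exact: IHm.
pose g := (2 ^ m).-root b; have gb : g ^+ (2 ^ m) = b by rewrite rootCK // expn_gt0.
have pg : root (toC (p \Po 'X^(2 ^ m))) g by rewrite root_comp_polyXn gb.
(* Otherwise [irredp_comp_X2] would keep the next level irreducible. *)
have [y Qy y2] : exists2 y, Qgen g y & y ^+ 2 = g.
  apply: NNPP => nsqg; case: nirr.
  have y2 : sqrtC g ^+ 2 = g by rewrite sqrtCK.
  rewrite expnSr -comp_polyXnXn; apply: (@irredp_comp_X2 _ (sqrtC g)); rewrite ?y2 //.
  by move=> Qy; apply: nsqg; exists (sqrtC g).
have g0 : g != 0 by apply: contraNneq b0 => g0; rewrite -gb g0 expr0n expn_eq0.
(* At level 0, [g] is [b] itself, which is not a square in [Q(b)]. *)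
case: m => [|m] in nirr IHm irr g gb pg Qy y2 g0 *.
  by case: nsq; exists y => //; move: Qy; rewrite -{1}gb expn0 expr1 // y2 -gb.
have ng : ~ Qgen (g ^+ 2) g.
  apply: (@irredp_comp_X2_Qgen (p \Po 'X^(2 ^ m))) => //.
    by rewrite comp_polyXnXn -expnSr.
  by rewrite root_comp_polyXn -exprM -expnS gb.
by exists m, g; have [] := Qgen_i_sqrt_tower ng Qy y2.
Qed.

(** * Descent along square roots *)

(** Induction on [N]: if [b = z^2] with [z] in [Q(b)], a [2^N]-th root of [z] in [Q(z)] would be a
    [2^(N+1)]-th root of [b] in [Q(b)]. The invariant [A] allows two uses, with and without a square
    root of -1 in the field. *)
Lemma datomic_descent (A : algC -> Prop) :
  (forall y, A (y ^+ 2) -> Qgen (y ^+ 2) y -> A y) ->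
  (forall (b : algC) (p : {poly rat}), A b -> irreducible_poly p -> root (toC p) b ->
    ~ (exists2 y, Qgen b y & y ^+ 2 = b) -> forall k, datomic (k, p)) ->
  forall (N : nat) (b : algC) (p : {poly rat}), A b ->
    (forall y, Qgen b y -> y ^+ (2 ^ N) <> b) ->
    irreducible_poly p -> root (toC p) b -> forall k, datomic (k, p).
Proof.
move=> Asqrt Anonsq; elim=> [|N IHN] b p Ab nroot irrp pb.
  by case: (nroot b (Qgen_id b)); rewrite expr1.
have [[y Qy y2]|nsq] := classic (exists2 y, Qgen b y & y ^+ 2 = b); last exact: Anonsq nsq.
apply: (@datomic_sqrt p y) => //; first by rewrite y2.
have at_root z q : z ^+ 2 = b -> Qgen b z -> irreducible_poly q -> root (toC q) z ->
    forall k, datomic (k, q).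
  move=> z2 Qz; apply: IHN; first by apply: Asqrt; rewrite z2.
  move=> x Qx xz; case: (nroot x (Qgen_trans Qz Qx)).
  by rewrite expnSr exprM xz.
move=> k q irrq /orP[] qz; first exact: at_root qz k.
by apply: at_root qz k => //; rewrite ?sqrrN //; apply: Qgen_opp.
Qed.

(** Two descents: the first treats roots whose field contains a square root of -1, and the second
    falls back on it after passing through [irredp_tower]. *)
Lemma datomic_of_finite_2power (p : {poly rat}) (b : algC) :
  (forall b : algC, b != 0 -> (forall n, (0 < n)%N -> b ^+ n <> 1) ->
    exists N : nat, forall y, Qgen b y -> y ^+ (2 ^ N) <> b) ->
  b != 0 -> (forall n, (0 < n)%N -> b ^+ n <> 1) ->
  irreducible_poly p -> root (toC p) b -> forall k, datomic (k, p).
Proof.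
move=> fin b0 bn irrp pb.
pose nru (b : algC) := b != 0 /\ (forall n, (0 < n)%N -> b ^+ n <> 1).
have nru_exp (g : algC) m : (0 < m)%N -> nru (g ^+ m) -> nru g.
  move=> m0 [g0 gn]; split; first by apply: contraNneq g0 => ->; rewrite expr0n gtn_eqF.
  by move=> n n0 e; apply: (gn n n0); rewrite exprAC e expr1n.
have atomic_i b' p' : nru b' -> Qgen_i b' -> irreducible_poly p' -> root (toC p') b' ->
    forall k, datomic (k, p').
  move=> nb ib; have [N HN] := fin b' nb.1 nb.2.
  apply: (@datomic_descent (fun b => nru b /\ Qgen_i b) _ _ N) => // {b0 bn pb b' p' nb ib N HN}.
    move=> y [ny iy] _; split; first exact: nru_exp ny.
    by apply: Qgen_i_sub iy; apply/Qgen_exp/Qgen_id.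
  move=> b' p' [nb ib] irrp' pb' nsq.
  have [//|[m [g [gb _ _ nig]]]] := irredp_tower nb.1 irrp' pb' nsq.
  (* Since [b'] is a power of [g^2], the square root of -1 in [Q(b')] also lies in [Q(g^2)]. *)
  case: nig; apply: Qgen_i_sub ib; rewrite -gb expnS exprM.
  exact/Qgen_exp/Qgen_id.
have [N HN] := fin b b0 bn.
apply: (@datomic_descent nru _ _ N) pb => // {b0 bn irrp p b N HN}.
  by move=> y ny _; apply: nru_exp ny.
move=> b p nb irrp pb nsq k.
have [//|[m [g [gb irr ig _]]]] := irredp_tower nb.1 irrp pb nsq.
(* At level [k + m.+1] the polynomial is still irreducible and has the root [g], to which the first
   descent applies. *)
apply: (@datomic_levelS k m.+1); apply: (@atomic_i g) => //.
  by apply: (@nru_exp g (2 ^ m.+1)%N); rewrite ?expn_gt0 // gb.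
by rewrite root_comp_polyXn gb.
Qed.

(** * Bounds on degrees and coefficients *)

(** With [d] the degree of [p], the [d + 1] powers of [h] modulo [p] lie in a space of dimension
    [d]; a linear relation among them gives [f]. *)
Lemma Qgen_degree (p : {poly rat}) (b x : algC) :
  p != 0 -> root (toC p) b -> Qgen b x ->
  exists f : {poly rat}, [/\ f != 0, (size f <= size p)%N & root (toC f) x].
Proof.
move=> p0 pb [h ex]; pose d := (size p).-1.
have ed : d.+1 = size p by rewrite /d prednK // size_poly_gt0.
pose A : 'M[rat]_(d.+1, d) := \matrix_(i < d.+1) poly_rV (h ^+ i %% p).
have : kermx A != 0.
  by rewrite kermx_eq0 /row_free neq_ltn ltnS rank_leq_col.
move/rowV0Pn => [v /sub_kermxP vA v0].
pose S := \sum_i v 0 i *: (h ^+ i %% p).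
have S0 : S = 0.
  have sS : (size S <= d)%N.
    apply: (leq_trans (size_sum _ _ _)); apply/bigmax_leqP => i _.
    by rewrite (leq_trans (size_scale_leq _ _)) // -ltnS [in X in (_ < X)%N]ed ltn_modp.
  rewrite -(poly_rV_K sS); suff -> : poly_rV S = 0 :> 'rV_d by rewrite linear0.
  rewrite -vA mulmx_sum_row linear_sum; apply: eq_bigr => i _.
  by rewrite linearZ /= rowK.
pose f := \poly_(i < d.+1) v 0 (inord i); exists f; split.
- apply: contra_neq v0 => f0; apply/rowP => i; rewrite mxE.
  have := coef_poly d.+1 (fun i => v 0 (inord i)) i.
  by rewrite -/f f0 coef0 ltn_ord inord_val.
- by rewrite -ed size_poly.
have ef : f \Po h = \sum_(i < d.+1) v 0 i *: h ^+ i.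
  rewrite /f poly_def linear_sum; apply: eq_bigr => i _ /=.
  by rewrite linearZ /= comp_Xn_poly inord_val.
have pf : p %| f \Po h.
  rewrite -[f \Po h]subr0 -S0 ef -sumrB.
  elim/big_ind: _ => [|? ? ? ?|i _]; [exact: dvdp0 | exact: dvdp_add |].
  rewrite -scalerBr -mul_polyC dvdp_mull //.
  by rewrite {1}(divp_eq (h ^+ i) p) addrK dvdp_mull.
have [r er] := dvdpP _ _ pf.
by rewrite /root ex -horner_comp -map_comp_poly er rmorphM hornerM (rootP pb) mulr0.
Qed.

Lemma toC_int (P : {poly int}) : toC (toQ P) = map_poly intr P.
Proof. by rewrite -map_poly_comp; apply: eq_map_poly => i /=; rewrite ratr_int. Qed.

(** Each factor [X - z] multiplies a bound on the coefficients by at most [1 + B]. *)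
Lemma coef_prod_XsubC_le (R : numDomainType) (B : R) (rs : seq R) (i : nat) :
  0 <= B -> {in rs, forall z, `|z| <= B} ->
  `|(\prod_(z <- rs) ('X - z%:P))`_i| <= (1 + B) ^+ size rs.
Proof.
move=> B0; elim: rs i => [|z rs IHrs] i Brs.
  by rewrite big_nil coef1 expr0; case: eqP => _; rewrite ?normr1 ?normr0.
have {}IHrs j := IHrs j (fun y yrs => Brs y (mem_behead (s := z :: rs) yrs)).
rewrite big_cons mulrBl coefB coefXM mul_polyC coefZ exprS mulrDl mul1r.
apply: (le_trans (ler_normB _ _)); apply: lerD; last first.
  by rewrite normrM ler_pM // Brs // mem_head.
by case: eqP => _ //; rewrite normr0 exprn_ge0 // addr_ge0.
Qed.

Lemma roots_norm_bound (p : {poly algC}) :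
  p != 0 -> exists2 B : algC, 1 <= B & forall z, root p z -> `|z| <= B.
Proof.
move=> p0; have [rs ep] := closed_field_poly_normal p.
have S0 : 0 <= \sum_(z <- rs) `|z| by apply: sumr_ge0 => *; apply: normr_ge0.
exists (1 + \sum_(z <- rs) `|z|); first by rewrite lerDl.
move=> z; rewrite ep rootZ ?lead_coef_eq0 // root_prod_XsubC => zrs.
rewrite (big_rem z) //= addrCA lerDl addr_ge0 //.
by apply: sumr_ge0 => *; apply: normr_ge0.
Qed.

(* The primitive minimal polynomial [Q] of [x] divides [P(X^n)] in [Z[X]], so its leading coefficient divides that of [P], while its roots are bounded since their [n]-th powers are roots of [P]. *)
Lemma minpoly_nth_root_bounded (P : {poly int}) (b : algC) :
  irreducible_poly (toQ P) -> root (toC (toQ P)) b ->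
  exists C : nat, forall (n : nat) (x : algC), (0 < n)%N -> Qgen b x -> x ^+ n = b ->
    exists Q : {poly int}, [/\ irreducible_poly (toQ Q), root (toC (toQ Q)) x,
      (size Q <= size P)%N & forall i, (absz (Q`_i)%R <= C)%N].
Proof.
move=> irrP Pb; have sQ (Q : {poly int}) : size (toQ Q) = size Q by apply: size_rat_int_poly.
have toQ0 (Q : {poly int}) : (toQ Q == 0) = (Q == 0) by rewrite -!size_poly_eq0 sQ.
have P0 : toC (toQ P) != 0 by rewrite map_poly_eq0 (irredp_neq0 irrP).
have [B B1 rootB] := roots_norm_bound P0.
have B0 : 0 <= B by apply: le_trans B1.
pose c := `|(lead_coef P)%:~R : algC| * (1 + B) ^+ size P.
have c0 : 0 <= c by rewrite mulr_ge0 // exprn_ge0 // addr_ge0.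
exists (Num.bound c) => n x n0 Qx xn.
have [q irrq qx] := algC_irredp x.
have Pnx : root (toC (toQ (P \Po 'X^n))) x.
  by rewrite map_comp_poly map_polyXn root_comp_polyXn xn.
have := Pnx; rewrite (irredp_root_dvdp _ irrq qx) => /dvdpP_rat_int[Q [a a0 eq] [r er]].
have eqQ : toQ Q %= q by rewrite eq eqp_sym eqp_scale.
have irrQ : irreducible_poly (toQ Q).
  split=> [|s s1]; first by rewrite (eqp_size eqQ); case: irrq.
  by rewrite (eqp_dvdr _ eqQ) => /(irrq.2 s s1) /eqp_trans; apply; rewrite eqp_sym.
have Qx0 : root (toC (toQ Q)) x by move: qx; rewrite eq linearZ /= rootZ // fmorph_eq0.
have Qn0 : Q != 0 by rewrite -toQ0 (irredp_neq0 irrQ).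
have szQ : (size Q <= size P)%N.
  have [f [f0 sf fx]] := Qgen_degree (irredp_neq0 irrP) Pb Qx.
  rewrite -!sQ; apply: leq_trans sf; apply: dvdp_leq => //.
  by rewrite -(irredp_root_dvdp _ irrQ Qx0).
exists Q; split=> // i.
have lcQ : `|(lead_coef Q)%:~R : algC| <= `|(lead_coef P)%:~R|.
  have := lead_coef_comp P (_ : 1 < size ('X^n : {poly int}))%N.
  rewrite size_polyXn ltnS => /(_ n0); rewrite lead_coefXn expr1n mulr1 er lead_coefM => <-.
  rewrite rmorphM normrM ler_peMr //; apply: norm_intr_ge1; first exact: intr_int.
  have : P \Po 'X^n != 0.
    by rewrite comp_poly_eq0 ?size_polyXn // -toQ0 (irredp_neq0 irrP).
  by rewrite er mulf_eq0 => /norP[_ r0]; rewrite /= intr_eq0 lead_coef_eq0.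
have [rs eQ] := closed_field_poly_normal (toC (toQ Q)).
have lcQ0 : (lead_coef Q)%:~R != 0 :> algC by rewrite intr_eq0 lead_coef_eq0.
have lcE : lead_coef (toC (toQ Q)) = (lead_coef Q)%:~R.
  by rewrite toC_int; apply: lead_coef_map_eq.
have lc0 : lead_coef (toC (toQ Q)) != 0 by rewrite lcE.
have rsB : {in rs, forall z, `|z| <= B}.
  move=> z zrs; have Qz : root (toC (toQ Q)) z by rewrite eQ rootZ // root_prod_XsubC.
  have : root (toC (toQ (P \Po 'X^n))) z.
    rewrite er rmorphM /= (irredp_root_dvdp _ irrQ Qz).
    by rewrite dvdp_mulIl.
  rewrite map_comp_poly map_polyXn root_comp_polyXn => /rootB; rewrite normrX => zB.
  (* Because [1 <= B], a root with [|z| > B] would satisfy [|z|^n >= |z| > B]; the bound thus does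
     not depend on [n]. *)
  rewrite real_leNgt ?normr_real ?ger0_real //; apply/negP => Bz.
  have z1 := le_trans B1 (ltW Bz).
  by have := lt_le_trans Bz (le_trans (ler_eXnr n0 z1) zB); rewrite ltxx.
have srs : (size rs <= size P)%N.
  apply: leq_trans szQ; rewrite -sQ -(size_map_poly (ratr : rat -> algC)) eQ.
  by rewrite size_scale // size_prod_XsubC.
have : `|(Q`_i)%:~R : algC| <= c.
  have -> : (Q`_i)%:~R = (toC (toQ Q))`_i by rewrite toC_int coef_map.
  rewrite eQ coefZ normrM lcE ler_pM //.
  apply: le_trans (coef_prod_XsubC_le i B0 rsB) _.
  by rewrite ler_weXn2l // lerDl.
by move=> /le_lt_trans/(_ (archi_boundP c0))/ltW; rewrite -intr_norm -natr_absz ler_nat.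
Qed.

(* If [p] divided [p(X^n)], then [z => z^n] would map the finite set of roots of [p] to itself. *)
Lemma ndvdp_comp_polyXn (p : {poly rat}) (b : algC) (n : nat) :
  p != 0 -> root (toC p) b -> b != 0 -> (1 < n)%N ->
  (forall k, (0 < k)%N -> b ^+ k <> 1) -> ~ p %| p \Po 'X^n.
Proof.
move=> p0 pb b0 n1 bn pp.
have closed z : root (toC p) z -> root (toC p) (z ^+ n).
  rewrite -root_comp_polyXn; have [r ->] := dvdpP _ _ pp.
  by rewrite rmorphM rootM orbC => ->.
have roots i : root (toC p) (b ^+ (n ^ i)).
  by elim: i => [|i IHi] //; rewrite expnSr exprM closed.
have lt_neq i j : (i < j)%N -> b ^+ (n ^ i) <> b ^+ (n ^ j).
  move=> ij; have nij : (n ^ i < n ^ j)%N by rewrite ltn_exp2l.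
  rewrite -(subnKC (ltnW nij)) exprD => /esym e.
  apply: (bn (n ^ j - n ^ i)%N); first by rewrite subn_gt0.
  by apply: (mulfI (expf_neq0 (n ^ i) b0)); rewrite e mulr1.
(* These are [size p] distinct roots, one more than the degree allows. *)
have := @max_poly_roots _ (toC p) [seq b ^+ (n ^ i) | i <- iota 0 (size p)].
rewrite map_poly_eq0 size_map size_iota size_map_poly ltnn => /(_ p0) H.
apply: notF; apply: H; first by apply/allP => _ /mapP[i _ ->].
rewrite map_inj_in_uniq ?iota_uniq // => i j _ _ e.
by case: (ltngtP i j) => // /lt_neq; rewrite e.
Qed.

Lemma bounded_poly_pigeonhole (s C : nat) : exists M : nat,
  forall f : 'I_M -> {poly int},
    (forall i, (size (f i) <= s)%N) ->
    (forall i j, (absz ((f i)`_j)%R <= C)%N) ->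
  exists i j : 'I_M, (i < j)%N /\ f i = f j.
Proof.
pose T := {ffun 'I_s -> 'I_(C + C).+1}; exists #|T|.+1 => f sf Cf.
(* Adding [C] moves the coefficients from [[-C, C]] into [[0, 2C]]. *)
pose e i : T := [ffun j : 'I_s => inord (absz ((f i)`_j + C%:Z))].
have /injectivePn[i [j ij eij]] : ~~ injectiveb e.
  by apply/negP => /injectiveP/leq_card; rewrite card_ord ltnn.
have fij : f i = f j.
  apply/polyP => k; have [ks|sk] := ltnP k s; last first.
    by rewrite !nth_default // (leq_trans (sf _)).
  have := congr1 (fun g : T => val (g (Ordinal ks))) eij; rewrite !ffunE /=.
  have := Cf i k; have := Cf j k; move: (f i)`_k (f j)`_k => x y yC xC.
  rewrite !inordK; lia.
by move: ij; rewrite neq_ltn => /orP[ij|ij]; [exists i, j | exists j, i].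
Qed.

(** Otherwise, for some [i < j], a [2^i]-th root and a [2^j]-th root [z] of [b] share a minimal
    polynomial. Then [z^(2^i)] is a root of [P] whose [2^(j-i)]-th power is [b], so [P] divides
    [P(X^(2^(j-i)))]. *)
Lemma Qgen_finite_2power (b : algC) :
  b != 0 -> (forall n, (0 < n)%N -> b ^+ n <> 1) ->
  exists N : nat, forall y, Qgen b y -> y ^+ (2 ^ N) <> b.
Proof.
move=> b0 bn; apply: NNPP => /not_ex_all_not nroot.
have ex_root N : exists2 y, Qgen b y & y ^+ (2 ^ N) = b.
  apply: NNPP => ny; apply: (nroot N) => y Qy e; apply: ny; by exists y.
have [p irrp pb] := algC_irredp b.
have [P [c [c0 irrP ep]]] : exists (P : {poly int}) (c : rat),
    [/\ c != 0, irreducible_poly (toQ P) & p = c *: toQ P].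
  have [P [a a0 ep]] := rat_poly_scale p; exists P, a%:~R^-1.
  have a'0 : (a%:~R : rat)^-1 != 0 by rewrite invr_eq0 intr_eq0.
  have eqP : toQ P %= p by rewrite ep eqp_sym eqp_scale.
  split=> //; split=> [|s s1]; first by rewrite (eqp_size eqP); case: irrp.
  by rewrite (eqp_dvdr _ eqP) => /(irrp.2 s s1) /eqp_trans; apply; rewrite eqp_sym.
have Pb : root (toC (toQ P)) b by move: pb; rewrite ep linearZ /= rootZ // fmorph_eq0.
have [C HC] := minpoly_nth_root_bounded irrP Pb.
have [M HM] := bounded_poly_pigeonhole (size P) C.
pose is_min (i : 'I_M) (Q : {poly int}) : Prop := exists y,
  [/\ y ^+ (2 ^ i) = b, irreducible_poly (toQ Q), root (toC (toQ Q)) y,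
    (size Q <= size P)%N & forall j, (absz (Q`_j)%R <= C)%N].
have ex_min i : exists Q, is_min i Q.
  have [y Qy yb] := ex_root i.
  have [|Q [irrQ Qy0 sQ CQ]] := HC (2 ^ i)%N y _ Qy yb; first by rewrite expn_gt0.
  by exists Q, y.
have [f Hf] := fin_all_exists ex_min.
have [i|i j|i [j [ij fij]]] := HM f; try by have [y []] := Hf i.
have [y [yb irrQ Qy _ _]] := Hf i; have [z [zb _ Qz _ _]] := Hf j.
rewrite -fij in Qz; have P0 := irredp_neq0 irrP.
apply: (@ndvdp_comp_polyXn (toQ P) b (2 ^ (j - i))) => //.
  by rewrite -{1}(expn0 2) ltn_exp2l // subn_gt0.
have Pz : root (toC (toQ P)) (z ^+ (2 ^ i)).
  rewrite -root_comp_polyXn (irredp_root_dvdp _ irrQ Qz).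
  by rewrite -(irredp_root_dvdp _ irrQ Qy) root_comp_polyXn yb.
rewrite -(irredp_root_dvdp _ irrP Pz) root_comp_polyXn -exprM -expnD subnKC ?zb //.
exact: ltnW.
Qed.

(** * Cyclotomic polynomials *)

Lemma Cyclotomic_irredp (n : nat) (z : algC) : n.-primitive_root z ->
  irreducible_poly (toQ 'Phi_n) /\ root (toC (toQ 'Phi_n)) z.
Proof.
move=> zn; have Phiz : root (toC (toQ 'Phi_n)) z.
  by rewrite toC_int (Cintr_Cyclotomic zn) root_cyclotomic.
split=> //; have [p irrp pz] := algC_irredp z.
have [q [eq mq dvq]] := minCpolyP z.
have eqp_ : p %= toQ 'Phi_n.
  have pPhi : p %| toQ 'Phi_n by rewrite -(irredp_root_dvdp _ irrp pz).
  have <- : q = toQ 'Phi_n.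
    apply: (map_poly_inj (ratr : {rmorphism rat -> algC})).
    by rewrite -eq (minCpoly_cyclotomic zn) -(Cintr_Cyclotomic zn) -toC_int.
  by rewrite /eqp -dvq pz andbT -(irredp_root_dvdp _ irrp pz) -eq root_minCpoly.
split=> [|s s1]; first by rewrite -(eqp_size eqp_); case: irrp.
rewrite -(eqp_dvdr _ eqp_) => /(irrp.2 s s1) /eqp_trans; exact.
Qed.

Lemma totient_mul2 (n : nat) : (0 < n)%N -> ~~ odd n ->
  totient (n * 2) = (totient n * 2)%N.
Proof.
move=> n0 nodd; have [m m2 en] := pfactor_coprime (isT : prime 2) n0.
have m2X e : coprime m (2 ^ e) by rewrite coprime_sym coprimeXl.
have e0 : (0 < logn 2 n)%N.
  by rewrite lt0n; apply: contraNneq nodd => e0; rewrite en e0 muln1 -coprime2n.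
move: (logn 2 n) e0 en => [//|e] _ ->.
have tE d : totient (m * 2 ^ d.+1) = (totient m * 2 ^ d)%N.
  by rewrite totient_coprime // totient_pfactor // mul1n.
by rewrite -mulnA -expnSr !tE -mulnA -expnSr.
Qed.

(** The square of a primitive [2n]-th root of unity is a primitive [n]-th one, which gives
    divisibility; for even [n] the degrees agree by [totient_mul2]. *)
Lemma Cyclotomic_comp_X2 (n : nat) : (0 < n)%N -> ~~ odd n ->
  toQ 'Phi_n \Po 'X^2 %= toQ 'Phi_(n * 2).
Proof.
move=> n0 nodd.
have n20 : (0 < n * 2)%N by rewrite muln_gt0 n0.
have [z zn] := C_prim_root_exists n20.
have z2n : n.-primitive_root (z ^+ 2).
  by have := exp_prim_root zn 2; rewrite (gcdn_idPl _) ?dvdn_mull // mulnK.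
have [irr2 Phi2z] := Cyclotomic_irredp zn.
have [irr1 Phi1z] := Cyclotomic_irredp z2n.
rewrite eqp_sym -dvdp_size_eqp; last first.
  by rewrite -(irredp_root_dvdp _ irr2 Phi2z) root_comp_polyXn.
rewrite size_rat_int_poly size_Cyclotomic totient_mul2 // -(mulnK 1 (ltn0Sn 1)).
have -> : size (toQ 'Phi_n \Po 'X^2) = (size (toQ 'Phi_n \Po 'X^2)).-1.+1.
  rewrite prednK // size_poly_gt0 comp_poly_eq0 ?size_polyXn //.
  exact: irredp_neq0.
by rewrite size_comp_poly size_polyXn size_rat_int_poly size_Cyclotomic.
Qed.

Lemma datomic_Cyclotomic_even (n k : nat) : (0 < n)%N -> ~~ odd n ->
  datomic (k, toQ 'Phi_n).
Proof.
move=> n0 nodd; apply: datomic_irreducible => m.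
suff e : toQ 'Phi_n \Po 'X^(2 ^ m) %= toQ 'Phi_(n * 2 ^ m).
  have n20 : (0 < n * 2 ^ m)%N by rewrite muln_gt0 n0 expn_gt0.
  have [z /Cyclotomic_irredp[irr _]] := C_prim_root_exists n20.
  split=> [|s s1]; first by rewrite (eqp_size e); case: irr.
  by rewrite (eqp_dvdr _ e) => /(irr.2 s s1) /eqp_trans; apply; rewrite eqp_sym.
elim: m => [|m IHm]; first by rewrite comp_polyXr muln1 eqpxx.
rewrite expnSr -comp_polyXnXn mulnA; apply: eqp_trans (Cyclotomic_comp_X2 _ _).
- by case/andP: IHm => h1 h2; rewrite /eqp !dvdp_comp_poly.
- by rewrite muln_gt0 n0 expn_gt0.
- by rewrite oddM (negPf nodd).
Qed.

(** * Irreducible integer polynomials *)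

Lemma poly_int_unit (p : {poly int}) : p \is a GRing.unit -> p = 1 \/ p = -1.
Proof.
rewrite poly_unitE => /andP[/eqP p1 /orP[]/eqP e].
  by left; rewrite (size1_polyC (eq_leq p1)) e.
by right; rewrite (size1_polyC (eq_leq p1)) e polyCN.
Qed.

Lemma ring_irreducible_dvdp (P Q : {poly int}) :
  ring_irreducible P -> Q \is monic -> (1 < size Q)%N -> toQ Q %| toQ P ->
  P = Q \/ P = - Q.
Proof.
move=> [P0 [PU irrP]] mQ sQ; rewrite dvdp_rat_int => /dvdpP_int[r].
rewrite zprimitive_monic // => eP.
have [Qu|/poly_int_unit[r1|r1]] := irrP _ _ eP; [|left|right].
- by move: sQ; have [->|->] := poly_int_unit Qu; rewrite ?size_polyN size_poly1.
- by rewrite eP r1 mulr1.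
- by rewrite eP r1 mulrN1.
Qed.

(** Gauss's lemma: a rational factor is, up to a scalar, an integral one. *)
Lemma ring_irreducible_rat (P : {poly int}) :
  ring_irreducible P -> (1 < size P)%N -> irreducible_poly (toQ P).
Proof.
move=> [P0 [PU irrP]] sP; split=> [|q q1]; first by rewrite size_rat_int_poly.
move/dvdpP_rat_int=> [Q [a a0 eq] [r eP]].
have eqQ : q %= toQ Q by rewrite eq eqp_scale.
have [Qu|ru] := irrP _ _ eP.
  by move: q1; rewrite (eqp_size eqQ) size_rat_int_poly; have [->|->] := poly_int_unit Qu;
    rewrite ?size_polyN size_poly1.
apply: (eqp_trans eqQ); rewrite eP.
have [->|->] := poly_int_unit ru; first by rewrite mulr1 eqpxx.
by rewrite mulrN1 rmorphN -scaleN1r eqp_sym eqp_scale ?oppr_eq0 ?oner_eq0.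
Qed.

Unset Implicit Arguments.

Theorem theorem4p6 (P : {poly int}) :
  ring_irreducible P -> ~ datomic (dofZ P) ->
  P = 'X \/ P = - 'X \/
  exists n : nat, (0 < n)%N /\ odd n /\ (P = 'Phi_n \/ P = - 'Phi_n).
Proof.
move=> irrP natom; have P0 := irrP.1.
have [sP|sP] := leqP (size P) 1.
  case: natom; apply: datomic_const; rewrite size_rat_int_poly.
  by apply/eqP; rewrite eqn_leq sP size_poly_gt0.
have irrQ := ring_irreducible_rat irrP sP.
(* A single root decides: zero gives [X], a root of unity gives a cyclotomic polynomial, and any
   other root gives atomicity. *)
have [b Pb] := irredp_algC_root irrQ.
have [b0|b0] := eqVneq b 0.
  have XP : toQ 'X %| toQ P.
    have -> : toQ 'X = 'X - 0%:P by rewrite map_polyX subr0.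
    rewrite dvdp_XsubCl -(fmorph_root (ratr : {rmorphism rat -> algC})).
    by rewrite rmorph0 -b0.
  have [|e|e] := ring_irreducible_dvdp irrP (monicX _) _ XP; first by rewrite size_polyX.
    by left.
  by right; left.
have [bn|/not_all_ex_not[n nbn]] := classic (forall n, (0 < n)%N -> b ^+ n <> 1).
  case: natom.
  exact: datomic_of_finite_2power Qgen_finite_2power b0 bn irrQ Pb 0%N.
have [n0 /NNPP bn] := imply_to_and _ _ nbn.
have [m bm _] := prim_order_exists n0 bn.
have [irrPhi Phib] := Cyclotomic_irredp bm.
have PhiP : toQ 'Phi_m %| toQ P by rewrite -(irredp_root_dvdp _ irrPhi Phib).
have eP : P = 'Phi_m \/ P = - 'Phi_m.
  apply: ring_irreducible_dvdp => //; first exact: Cyclotomic_monic.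
  by case: irrPhi; rewrite size_rat_int_poly.
right; right; exists m; split; first exact: prim_order_gt0 bm.
split=> //; apply/negPn/negP => modd; case: natom.
have /(datomic_Cyclotomic_even 0) := prim_order_gt0 bm => /(_ modd).
apply: datomic_eqp; case: eP => ->; first exact: eqpxx.
by rewrite rmorphN -scaleN1r eqp_sym eqp_scale ?oppr_eq0 ?oner_eq0.
Qed.
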